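(* Let $M_\theta(Q,\mathbf r)$ be a Fano quiver flag variety, let $1\le i\le\rho$, and let $\lambda$ be a partition with at most $r_i$ parts such that $\lambda_1\ge s_i-r_i+1$. Then in the small quantum cohomology ring of $M_\theta(Q,\mathbf r)$ $$s^i_\lambda=\sum_{k=1}^{s_i}\sum_{\sum k_a=k}(-1)^{k+1}\,\mathrm{RH}^{s_i}\big(s^i_{\lambda+\{s_i-k\}}\big)\prod_{a\in Q_1,\, t(a)=i}s^{s(a)}_{(k_a)^t}\;+\;(-1)^{r_i-1}q_i\sum_{k=0}^{s_i'}\sum_{\sum k_a=k}(-1)^{s_i'-k}\,\mathrm{RH}^{s_i}\big(s^i_{\lambda+\{s_i'-k\}}\big)\prod_{a\in Q_1,\, s(a)=i}s^{t(a)}_{(k_a)^t}.$$ The first inner sum is over all integers $0\le k_a\le r_{s(a)}$, one for each arrow $a$ with $t(a)=i$, with $\sum k_a=k$; the second is over all integers $0\le k_a\le r_{t(a)}$, one for each arrow $a$ with $s(a)=i$, with $\sum k_a=k$ (if there is no arrow with source $i$, then $s_i'=0$ and the double sum has the single term with $k=0$ and empty product $1$).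
   Context: Quiver flag varieties. $Q=(Q_0,Q_1)$ is a finite acyclic quiver with a unique source; $Q_0=\{0,1,\dots,\rho\}$, $0$ is the source, and the number $n_{ij}$ of arrows from $i$ to $j$ is zero unless $i<j$. For an arrow $a\in Q_1$, $s(a),t(a)$ are its source and target. $\mathbf r=(r_0,\dots,r_\rho)$ is a vector of positive integers with $r_0=1$. Let $\mathrm{Rep}(Q,\mathbf r)=\bigoplus_{a\in Q_1}\mathrm{Hom}(\mathbb C^{r_{s(a)}},\mathbb C^{r_{t(a)}})$, on which $G=\prod_{i=1}^\rho \mathrm{GL}(r_i)$ acts by change of basis. The quiver flag variety $M_\theta(Q,\mathbf r)$ is the GIT quotient $\mathrm{Rep}(Q,\mathbf r)/\!/_\theta G$ with $\theta(g)=\prod_{i=1}^\rho\det(g_i)$. Equivalently it is a tower of Grassmannian bundles: $M_0$ is a point, $W_0$ is the trivial line bundle, and inductively $M_i=\mathrm{Gr}(\bigoplus_{a\in Q_1,t(a)=i}W_{s(a)},r_i)$ is the relative Grassmannian of rank $r_i$ quotients over $M_{i-1}$, with tautological quotient bundle $W_i$ of rank $r_i$; then $M_\theta(Q,\mathbf r)=M_\rho$. Put $s_i=\sum_{a\in Q_1,t(a)=i}r_{s(a)}$ and $s_i'=\sum_{a\in Q_1,s(a)=i}r_{t(a)}$. Standing assumptions: $s_i-r_i>0$ for all $1\le i\le\rho$, and $Q$ is graph-reduced, i.e. there is no graftable subquiver (no subquiver attached to the rest of the quiver only through a single non-source vertex of dimension $1$, which could be moved to the source without changing the variety). For graph-reduced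 quivers the ample cone is the positive orthant in the basis $c_1(W_1),\dots,c_1(W_\rho)$ of $H^2$, and $M_\theta(Q,\mathbf r)$ is Fano if and only if $s_i-s_i'>0$ for all $i$. Small quantum cohomology: $H^*(M_\theta(Q,\mathbf r),\mathbb C)\otimes\mathbb C[q_1,\dots,q_\rho]$ with the product defined by three-point genus-zero Gromov–Witten invariants weighted by $q^d=\prod_iq_i^{d_i}$, $d_i=\int_dc_1(W_i)$. It is presented as $\mathbb C[x_{ij},q_i:1\le i\le\rho,1\le j\le r_i]^W/I_q$, where $W=\prod_i S_{r_i}$ permutes $x_{i1},\dots,x_{ir_i}$ for each $i$ (the Chern roots of $W_i$), $I_q$ is generated by the $W$-invariant $f$ with $\omega f\in I^{ab}_q$, $\omega=\prod_i\prod_{j<k}(x_{ij}-x_{ik})$, and $I_q^{ab}$ is generated by $\prod_{t(a)=i}\prod_{k=1}^{r_{s(a)}}(-x_{s(a)k}+x_{ij})-(-1)^{r_i-1}q_i\prod_{s(a)=i}\prod_{k=1}^{r_{t(a)}}(-x_{ij}+x_{t(a)k})$ for all $i,j$ ($x_{01}=0$). $s^i_\lambda$ is the image in this ring of the Schur polynomial of $\lambda$ in $x_{i1},\dots,x_{ir_i}$; all products are taken in this ring. Also $s^i_\emptyset=1$ and $s^0_\lambda=0$ for $\lambda\neq\emptyset$. $(k)^t=(1,\dots,1)$ ($k$ ones). $\lambda+\{m\}$ denotes the partition obtained from $\lambda$ by adding $m$ to its first entry. Rim-hooks. The rim-hook of length $n$ of a partition $\lambda$ is the connected path of $n$ boxes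 in the Young diagram of $\lambda$ starting at the last box of the first row and staying on the rim (the boxes having no box of $\lambda$ diagonally south-east of them); it is unique if it exists. The length $n$ rim-hook removal is said to exist if such a path exists and deleting it from $\lambda$ leaves a partition $\lambda'$. The height $h$ is the number of rows met by the path. Set $\mathrm{RH}^n(s_\lambda)=(-1)^{h+1}s_{\lambda'}$ if the removal exists and $0$ otherwise; the same notation is used for $s^i_\lambda$. *)

(* Defs.v *)
From HB Require Import structures.
From mathcomp Require Import all_boot all_order all_algebra all_fingroup.
From mathcomp Require Import generic_quotient ring_quotient.
From mathcomp Require Import boolp reals.
From mathcomp Require Import complex mpoly zify.
Import Order.TTheory GRing.Theory Num.Theory.
Import Pdiv.CommonRing Pdiv.RingMonic.

Set Implicit Arguments.
Unset Strict Implicit.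
Unset Printing Implicit Defensive.

Local Open Scope ring_scope.
Local Open Scope quotient_scope.

(** The quotient construction of [ring_quotient] asks for a proper ideal;
    here the ideal is arbitrary, so the quotient is only a [comPzRingType]. *)

Section GeneratedIdeal.
Variables (A : comNzRingType) (S : A -> Prop).

Definition in_ideal (f : A) : Prop :=
  exists (n : nat) (c g : 'I_n -> A),
    (forall k, S (g k)) /\ f = \sum_k c k * g k.

Definition ideal_pred : {pred A} := fun f => `[< in_ideal f >].

Lemma ideal_predP f : reflect (in_ideal f) (f \in ideal_pred).
Proof. exact: asboolP. Qed.

Lemma ideal_predM a f : f \in ideal_pred -> a * f \in ideal_pred.
Proof.
move=> /ideal_predP[n [c [g [Sg ->]]]]; apply/ideal_predP.
exists n, (fun k => a * c k), g; split=> //.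
by rewrite mulr_sumr; apply: eq_bigr => k _; rewrite mulrA.
Qed.

Lemma ideal_pred_zmod : zmod_closed ideal_pred.
Proof.
split.
  apply/ideal_predP; exists 0%N, (fun=> 0), (fun=> 0).
  by split; [case | rewrite big_ord0].
move=> f h /ideal_predP[n [c [g [Sg ->]]]].
move=> /ideal_predP[m [d [e [Se ->]]]].
apply/ideal_predP; exists (n + m)%N,
  (fun k => match split k with inl k => c k | inr k => - d k end),
  (fun k => match split k with inl k => g k | inr k => e k end).
split=> [k|]; first by case: (split k).
rewrite big_split_ord /= -sumrN; congr (_ + _); apply: eq_bigr => k _.
  by rewrite (unsplitK (inl k)).
by rewrite (unsplitK (inr k)) mulNr.
Qed.

HB.instance Definition _ :=
  GRing.isZmodClosed.Build A ideal_pred ideal_pred_zmod.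

Definition quot_ring : Type := Quotient.quot ideal_pred.
HB.instance Definition _ := GRing.Zmodule.on quot_ring.
HB.instance Definition _ :=
  EqQuotient.copy quot_ring (Quotient.quot ideal_pred).

Definition quot_class (f : A) : quot_ring := \pi_(quot_ring) f.

Definition quot_one : quot_ring := quot_class 1.
Definition quot_mul (u v : quot_ring) : quot_ring :=
  quot_class (repr u * repr v).

Lemma quot_classP f g : quot_class f = quot_class g <-> f - g \in ideal_pred.
Proof.
rewrite (Quotient.idealrBE ideal_pred); split=> [e|/eqP //].
by apply/eqP.
Qed.

Lemma repr_quot_class f : f - repr (quot_class f) \in ideal_pred.
Proof. by apply/quot_classP; rewrite /quot_class reprK. Qed.

Lemma quot_classM f g :
  quot_class (f * g) = quot_mul (quot_class f) (quot_class g).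
Proof.
apply/quot_classP; set f' := repr _; set g' := repr _.
have -> : f * g - f' * g' = f * (g - g') + g' * (f - f').
  by rewrite !mulrBr [g' * f]mulrC [g' * f']mulrC addrA subrK.
by rewrite rpredD ?ideal_predM ?repr_quot_class.
Qed.

Lemma quot_class_surj u : exists f, u = quot_class f.
Proof. by exists (repr u); rewrite /quot_class reprK. Qed.

Lemma quot_classD f g : quot_class (f + g) = quot_class f + quot_class g.
Proof. exact: (raddfD (\pi_(Quotient.quot ideal_pred))). Qed.

Lemma quot_mulA : associative quot_mul.
Proof.
move=> u v w; have [[f ->] [g ->] [h ->]] :=
  And3 (quot_class_surj u) (quot_class_surj v) (quot_class_surj w).
by rewrite -!quot_classM mulrA.
Qed.

Lemma quot_mulC : commutative quot_mul.
Proof. by move=> u v; rewrite /quot_mul mulrC. Qed.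

Lemma quot_mul1 : left_id quot_one quot_mul.
Proof.
by move=> u; have [f ->] := quot_class_surj u; rewrite -quot_classM mul1r.
Qed.

Lemma quot_mulDl : left_distributive quot_mul +%R.
Proof.
move=> u v w; have [[f ->] [g ->] [h ->]] :=
  And3 (quot_class_surj u) (quot_class_surj v) (quot_class_surj w).
by rewrite -quot_classD -!quot_classM mulrDl quot_classD.
Qed.

HB.instance Definition _ := GRing.Zmodule_isComPzRing.Build quot_ring
  quot_mulA quot_mulC quot_mul1 quot_mulDl.

Lemma quot_class_zmod : zmod_morphism quot_class.
Proof. exact: (raddfB (\pi_(Quotient.quot ideal_pred))). Qed.

Lemma quot_class_monoid : monoid_morphism quot_class.
Proof. by split=> // f g; apply: quot_classM. Qed.

HB.instance Definition _ :=
  GRing.isZmodMorphism.Build A quot_ring quot_class quot_class_zmod.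
HB.instance Definition _ :=
  GRing.isMonoidMorphism.Build A quot_ring quot_class quot_class_monoid.

End GeneratedIdeal.

(** A partition is the list of its nonzero parts. *)
Definition is_part (la : seq nat) : bool := sorted geq la && (0%N \notin la).

Definition staircase n (k : 'I_n) : nat := (n - k.+1)%N.

(* Reduce the powers modulo [\prod_j ('X - a_j)], which is monic of degree
   [n]. *)
Lemma powers_det_dvd (A : comNzRingType) n (a : 'I_n -> A) (al : 'I_n -> nat) :
  exists d : A, d * \det (\matrix_(k, j) a j ^+ staircase k)
              = \det (\matrix_(k, j) a j ^+ al k).
Proof.
pose P : {poly A} := \prod_(j < n) ('X - (a j)%:P).
have monP : P \is monic by apply: monic_prod => j _; apply: monicXsubC.
have szP : size P = n.+1 by rewrite size_prod_XsubC /index_enum -enumT size_enum_ord.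
pose c := \matrix_(k < n, l < n) (rmodp 'X^(al k) P)`_(staircase l).
exists (\det c); rewrite -det_mulmx; congr (\det _).
apply/matrixP => k j; rewrite !mxE.
have rootP : P.[a j] = 0.
  by rewrite horner_prod (bigD1 j) //= hornerXsubC subrr mul0r.
have -> : a j ^+ al k = (rmodp 'X^(al k) P).[a j].
  have := congr1 (horner^~ (a j)) (rdivp_eq monP 'X^(al k)).
  by rewrite hornerXn hornerD hornerM rootP mulr0 add0r.
rewrite (@horner_coef_wide _ n); last by rewrite -ltnS -szP ltn_rmodpN0 ?monic_neq0.
rewrite [RHS](reindex_inj rev_ord_inj) /=; apply: eq_bigr => l _.
by rewrite !mxE.
Qed.

Lemma comp_mpoly_comp (A : comNzRingType) n m l (f : n.-tuple {mpoly A[m]})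
    (g : m.-tuple {mpoly A[l]}) (p : {mpoly A[n]}) :
  (p \mPo f) \mPo g = p \mPo [tuple (tnth f k) \mPo g | k < n].
Proof.
rewrite (comp_mpolyEX p f) raddf_sum (comp_mpolyEX p); apply: eq_bigr => e _.
rewrite /= comp_mpolyZ !comp_mpolyX rmorph_prod; congr (_ *: _).
by apply: eq_bigr => k _; rewrite rmorphXn tnth_mktuple.
Qed.

Lemma msym_comp (A : comNzRingType) n m (s : 'S_n) (f : n.-tuple {mpoly A[m]})
    (p : {mpoly A[n]}) :
  msym s p \mPo f = p \mPo [tuple tnth f (s k) | k < n].
Proof.
have -> : msym s p = p \mPo [tuple 'X_(s k) | k < n].
  rewrite /msym /comp_mpoly /mmap; apply: eq_bigr => e _; congr (_ * _).
  by apply: mmap1_eq => k; rewrite tnth_mktuple.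
rewrite comp_mpoly_comp; congr comp_mpoly; apply: eq_from_tnth => k.
by rewrite !tnth_mktuple comp_mpolyXU -tnth_nth.
Qed.

Section Schur.
Variables (K : idomainType) (n : nat).

Definition alternant (al : 'I_n -> nat) : {mpoly K[n]} :=
  \det (\matrix_(k, j) 'X_j ^+ al k).

Definition shifted (la : seq nat) (k : 'I_n) : nat := (nth 0 la k + staircase k)%N.

Lemma alternant_dvd (al : 'I_n -> nat) :
  exists p : {mpoly K[n]}, p * alternant (@staircase n) == alternant al.
Proof.
have [p e] := powers_det_dvd (fun j : 'I_n => 'X_j : {mpoly K[n]}) al.
by exists p; apply/eqP.
Qed.

Lemma staircase_neq0 : alternant (@staircase n) != 0.
Proof.
pose a : 'rV[{mpoly K[n]}]_n := \row_j 'X_j.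
have -> : alternant (@staircase n) = \det (row_perm (perm rev_ord_inj) (Vandermonde n a)).
  by congr (\det _); apply/matrixP => k j; rewrite !mxE permE.
rewrite row_permE det_mulmx det_perm mulf_neq0 ?signr_eq0 // det_Vandermonde.
apply/prodf_neq0 => i _; apply/prodf_neq0 => j ltij; rewrite !mxE.
rewrite subr_eq0; apply/eqP => /(congr1 (mcoeff U_(i))).
rewrite !mcoeffX eqxx.
have -> : (U_(j) == U_(i))%MM = false.
  apply/eqP => /(congr1 (fun m : 'X_{1..n} => m i)); rewrite !mnm1E eqxx.
  by case: eqP ltij => // ->; rewrite ltnn.
by move/eqP; rewrite eq_sym oner_eq0.
Qed.

(** The Schur polynomial as the quotient of alternants
    [det (x_j^(la_k + n - k)) / det (x_j^(n - k))], and zero when [la] has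
    more than [n] parts. The quotient is unique since the denominator is
    nonzero ([staircase_neq0]). *)
Definition schur (la : seq nat) : {mpoly K[n]} :=
  if (size la <= n)%N then xchoose (alternant_dvd (shifted la)) else 0.

Lemma schurP la : (size la <= n)%N ->
  schur la * alternant (@staircase n) = alternant (shifted la).
Proof. by rewrite /schur => ->; apply/eqP/(xchooseP (alternant_dvd _)). Qed.

Lemma alternant_perm (s : 'S_n) (al : 'I_n -> nat) :
  msym s (alternant al) = (-1) ^+ s * alternant al.
Proof.
rewrite /alternant -det_map_mx -[s : bool]odd_permV -det_perm mulrC -det_mulmx.
rewrite -col_permE; congr (\det _); apply/matrixP => k j.
by rewrite !mxE rmorphXn /= /msym mmapX mmap1U.
Qed.

Lemma schur_sym (s : 'S_n) la : msym s (schur la) = schur la.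
Proof.
case: (leqP (size la) n) => [le|gt]; last first.
  by rewrite /schur leqNgt gt /= raddf0.
apply: (mulIf staircase_neq0); apply: (@mulfI _ ((-1) ^+ s)).
  by rewrite signr_eq0.
by rewrite mulrCA -alternant_perm -rmorphM schurP //= alternant_perm.
Qed.

End Schur.


(** Boxes are pairs (row, column), both counted from zero. *)

Section RimHooks.
Local Open Scope nat_scope.
Implicit Types (la : seq nat) (b c : nat * nat) (p : seq (nat * nat)).

Definition in_diagram la b : bool := (b.2 < nth 0 la b.1)%N.

Definition boxes la : seq (nat * nat) :=
  [seq (i, j) | i <- iota 0 (size la), j <- iota 0 (nth 0 la i)].

Definition on_rim la b : bool :=
  in_diagram la b && ~~ in_diagram la (b.1.+1, b.2.+1).

Definition adjacent b c : bool :=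
  (b.1 == c.1) && ((b.2.+1 == c.2) || (c.2.+1 == b.2)) ||
  (b.2 == c.2) && ((b.1.+1 == c.1) || (c.1.+1 == b.1)).

Definition first_row_end la : nat * nat := (0, (head 0 la).-1)%N.

Definition is_rim_hook la n p : bool :=
  [&& size p == n, ohead p == Some (first_row_end la), uniq p,
      sorted adjacent p & all (on_rim la) p].

Definition rim_step la b : nat * nat :=
  if in_diagram la (b.1.+1, b.2) then (b.1.+1, b.2) else (b.1, b.2.-1).

(* The only possible rim hook of length [n], see [is_rim_hook_walk]; if the
   rim is too short the walk stalls in column zero and is not [uniq]. *)
Definition rim_walk la n : seq (nat * nat) :=
  traject (rim_step la) (first_row_end la) n.

Lemma nth_part la i j : is_part la -> (i <= j)%N -> (nth 0 la j <= nth 0 la i)%N.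
Proof.
move=> /andP[srt _] leij; case: (ltnP j (size la)) => [ltj|gej]; last first.
  by rewrite nth_default.
apply: (@sorted_leq_nth _ geq) => //; last by rewrite inE (leq_ltn_trans leij).
  by move=> y x z /= yx zy; apply: leq_trans zy yx.
by move=> x /=.
Qed.

Lemma rim_adjacent la b c : is_part la -> on_rim la b -> on_rim la c ->
  adjacent b c -> c = rim_step la b \/ b = rim_step la c.
Proof.
move=> pla; case: b c => [b1 b2] [c1 c2]; rewrite /on_rim /in_diagram /adjacent /=.
move=> /andP[Hb1 Hb2] /andP[Hc1 Hc2]; rewrite /rim_step /in_diagram /=.
case/orP => /andP[/eqP e] /orP[/eqP f|/eqP f]; subst => /=.
- by right; rewrite ifF //; apply/negbTE.
- by left; rewrite ifF //; apply/negbTE.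
- by left; rewrite Hc1.
- by right; rewrite Hb1.
Qed.

Lemma rim_step_inj la b c : is_part la -> on_rim la b -> on_rim la c ->
  on_rim la (rim_step la b) -> b != rim_step la b -> c != rim_step la c ->
  rim_step la b = rim_step la c -> b = c.
Proof.
move=> pla; case: b c => [b1 b2] [c1 c2]; rewrite /on_rim /rim_step /in_diagram /=.
move=> /andP[Hb1 Hb2] /andP[Hc1 Hc2].
case: ifP => Sb; case: ifP => Sc /= _ nb nc [] e1 e2.
- by rewrite e1 e2.
- by subst; move: nc; rewrite xpair_eqE; lia.
- by subst; move: nb; rewrite xpair_eqE; lia.
- by move: nb nc; rewrite e1 !xpair_eqE !eqxx /= => nb nc; congr pair; lia.
Qed.

Lemma is_rim_hook_walk la n p :
  is_part la -> is_rim_hook la n p -> p = rim_walk la n.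
Proof.
move=> pla.
have walk: forall p u b, (b == first_row_end la) ||
   [&& on_rim la u, u \notin b :: p, u != b & b == rim_step la u] ->
   uniq (b :: p) -> path adjacent b p -> all (on_rim la) (b :: p) ->
   p = traject (rim_step la) (rim_step la b) (size p).
  elim=> [//|c q IH] u b hu /= /andP[nb uq] /andP[abc pq] /and3P[rb rc aq].
  have cE : c = rim_step la b.
    have [//|bE] := rim_adjacent pla rb rc abc.
    have nbc : c != b by apply: contraNneq nb => ->; rewrite mem_head.
    case/orP: hu => [/eqP bf|/and4P[ru nu nub /eqP bu]].
      move: bE rc nbc; rewrite bf /first_row_end /rim_step /on_rim /in_diagram.
      case: ifP => // _; rewrite -nth0.
      case: (c) => [c1 c2] /= [<- e] /andP[lt _].
      by rewrite xpair_eqE eqxx /=; lia.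
    have uc : u = c by apply: (rim_step_inj pla ru rc); rewrite -?bu -?bE.
    by case/negP: nu; rewrite uc !inE eqxx orbT.
  rewrite {1}cE; congr cons; rewrite -cE.
  apply: (IH b) => //=; last by rewrite rc.
  rewrite rb nb -cE eqxx andbT /= orbC; apply/orP; left.
  by apply: contraNneq nb => ->; rewrite mem_head.
case: p => [|b p] /and5P[/eqP <-] // /eqP[E] up /= pp ap.
rewrite /rim_walk /= -E; congr cons.
by apply: (walk p b b); rewrite // E eqxx.
Qed.

Definition hook_height p : nat := size (undup (map fst p)).

Definition remove_boxes la p : seq nat :=
  [seq m <- [seq count (fun j => (i, j) \notin p) (iota 0 (nth 0 la i))
            | i <- iota 0 (size la)] | 0 < m].

(* The last conjunct makes sure that the boxes of [la] outside [p] are indeed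
   the diagram of [remove_boxes la p]. *)
Definition rim_removal_exists la n : bool :=
  let p := rim_walk la n in let mu := remove_boxes la p in
  [&& is_rim_hook la n p, is_part mu &
      all (fun b => in_diagram mu b == (b \notin p)) (boxes la)].

(** [RH n s la] is RH^n(s_la) for a family [s] of ring elements indexed by
    partitions. *)
Definition RH (A : pzRingType) (n : nat) (s : seq nat -> A) la : A :=
  let p := rim_walk la n in
  if rim_removal_exists la n
  then ((-1) ^+ (hook_height p).+1 * s (remove_boxes la p))%R
  else 0%R.

Definition add_first la (m : nat) : seq nat :=
  if la is a :: mu then (a + m)%N :: mu else nseq (0 < m)%N m.

End RimHooks.

(** A finite acyclic quiver on the vertices [0, ..., rho] whose unique source
    is [0] and whose arrows all increase the vertex. *)
Record quiver := Quiver {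
  rho : nat;
  arrow : finType;
  src : arrow -> 'I_rho.+1;
  tgt : arrow -> 'I_rho.+1;
  src_lt_tgt : forall a, (src a < tgt a)%N;
  source_uniq : forall i, i != ord0 -> exists a, tgt a = i }.

Definition vertex (Q : quiver) : finType := 'I_(rho Q).+1.

Section QuiverFlag.
Variables (Q : quiver) (r : vertex Q -> nat).
Implicit Types i : vertex Q.

Definition arrow_into i : finType := {a : arrow Q | tgt a == i}.
Definition arrow_from i : finType := {a : arrow Q | src a == i}.

Definition s_in i : nat := (\sum_(a : arrow_into i) r (src (val a)))%N.
Definition s_out i : nat := (\sum_(a : arrow_from i) r (tgt (val a)))%N.

(** The subquiver on [J] is attached to the rest of the quiver only through
    the non-source vertex [i], which has dimension 1. *)
Definition graftable i (J : {set vertex Q}) : Prop :=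
  [/\ i != ord0, r i = 1%N, J != set0, (ord0 \notin J) && (i \notin J)
    & forall a : arrow Q, (src a \in J) != (tgt a \in J) ->
        src a = i \/ tgt a = i].

Definition graph_reduced : Prop := ~ exists i J, graftable i J.

(** Divisor classes are given by their coordinates in the basis [c_1(W_i)],
    [i != 0]. The tangent bundle has an iterated extension by the relative
    tangent bundles [Hom(S_i, W_i)], where [S_i] is the kernel of
    [\bigoplus_(t(a) = i) W_(s(a)) -> W_i], whence
    [c_1(T) = \sum_i (s_i c_1(W_i) - r_i \sum_(t(a) = i) c_1(W_(s(a))))]. *)
Definition divisor_class : Type := vertex Q -> int.

Definition anticanonical : divisor_class :=
  fun i => (s_in i)%:Z - (s_out i)%:Z.

(** For a graph-reduced quiver the ample cone is the positive orthant. *)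
Definition ample (D : divisor_class) : Prop := forall i, i != ord0 -> 0 < D i.

Definition Fano : Prop := ample anticanonical.

Variable K : idomainType.

(** One variable [x_ij] for [i != 0] and [j < r_i], and one variable [q_i]
    for [i != 0]. *)
Definition xvar : finType :=
  {v : {i : vertex Q & 'I_(r i)} | tag v != ord0}.
Definition qvar : finType := {i : vertex Q | i != ord0}.
Definition var : finType := (xvar + qvar)%type.

Local Notation P := {mpoly K[#|var|]}.

Definition pvar (v : var) : P := 'X_(enum_rank v).

(** With the convention [x_01 = 0]. *)
Definition x_root i (j : 'I_(r i)) : P :=
  if insub (Tagged (fun i => 'I_(r i)) j) is Some v then pvar (inl v) else 0.

(** The value [0] at the source is irrelevant. *)
Definition q_par i : P := if insub i is Some v then pvar (inr v) else 0.

(** [S_(r_0)] acts trivially, as [r_0 = 1]. *)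
Definition weyl : finType := {dffun forall i : vertex Q, 'S_(r i)}.

Definition weyl_var (w : weyl) (v : var) : P :=
  match v with
  | inl u => x_root (w (tag (val u)) (tagged (val u)))
  | inr _ => pvar v
  end.

Definition weyl_act (w : weyl) (f : P) : P :=
  f \mPo [tuple weyl_var w (enum_val k) | k < #|var|].

Definition weyl_inv : {pred P} := fun f => [forall w, weyl_act w f == f].

Lemma weyl_inv_subring : subring_closed weyl_inv.
Proof.
split=> [|f g /forallP If /forallP Ig|f g /forallP If /forallP Ig];
  apply/forallP => w; rewrite /weyl_act ?rmorph1 ?rmorphB ?rmorphM //=;
  by move: (eqP (If w)) (eqP (Ig w)); rewrite /weyl_act => -> ->.
Qed.

HB.instance Definition _ := GRing.isSubringClosed.Build P weyl_inv weyl_inv_subring.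

Record inv_ring := InvRing { inv_val :> P; _ : inv_val \in weyl_inv }.

HB.instance Definition _ := [isSub for inv_val].
HB.instance Definition _ := [Choice of inv_ring by <:].
HB.instance Definition _ := [SubChoice_isSubComNzRing of inv_ring by <:].

Definition ab_relation i (j : 'I_(r i)) : P :=
  \prod_(a : arrow_into i) \prod_(k < r (src (val a))) (- x_root k + x_root j)
  - (-1) ^+ (r i).-1 * q_par i
    * \prod_(a : arrow_from i) \prod_(k < r (tgt (val a))) (- x_root j + x_root k).

Definition I_ab : P -> Prop :=
  in_ideal (fun g => exists i (j : 'I_(r i)), i != ord0 /\ g = ab_relation j).

Definition omega : P :=
  \prod_(i : vertex Q | i != ord0)
    \prod_(j < r i) \prod_(k < r i | (j < k)%N) (x_root j - x_root k).

(** The small quantum cohomology ring through its presentation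
    [K[x, q]^W / I_q], with [I_q] the ideal of the invariant ring generated by
    the invariant [f] such that [omega f] lies in [I_ab]. *)
Definition QH : comPzRingType :=
  quot_ring (fun f : inv_ring => I_ab (omega * inv_val f)).

Definition QH_class (f : inv_ring) : QH := quot_class _ f.

Lemma weyl_act_x (w : weyl) i (j : 'I_(r i)) : weyl_act w (x_root j) = x_root (w i j).
Proof.
rewrite /weyl_act {1}/x_root; case: insubP => [u hu eu|]; last first.
  rewrite negbK /= => /eqP i0; rewrite raddf0 /x_root insubF //=.
  by rewrite i0 eqxx.
rewrite comp_mpolyXU -tnth_nth tnth_mktuple enum_rankK /=.
by rewrite eu.
Qed.

Lemma weyl_act_q (w : weyl) i : weyl_act w (q_par i) = q_par i.
Proof.
rewrite /weyl_act {1}/q_par /q_par; case: insub => [u|]; last by rewrite raddf0.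
by rewrite comp_mpolyXU -tnth_nth tnth_mktuple enum_rankK.
Qed.

Lemma q_inv i : q_par i \in weyl_inv.
Proof. by apply/forallP => w; rewrite weyl_act_q. Qed.

Definition schur_x i (la : seq nat) : P :=
  schur K (r i) la \mPo [tuple x_root j | j < r i].

Lemma schur_x_inv i la : schur_x i la \in weyl_inv.
Proof.
apply/forallP => w; apply/eqP.
rewrite /schur_x -[in RHS](schur_sym _ (w i)) msym_comp /weyl_act comp_mpoly_comp.
congr comp_mpoly; apply: eq_from_tnth => j.
by rewrite !tnth_mktuple -weyl_act_x.
Qed.

Definition qQ i : QH := QH_class (InvRing (q_inv i)).

Definition sQ i (la : seq nat) : QH :=
  if i == ord0 then (la == [::])%:R else QH_class (InvRing (schur_x_inv i la)).

End QuiverFlag.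

Arguments qQ [Q] r K i.
Arguments sQ [Q] r K i la.

(* Main.v *)
(** Multiplied by the denominator [a_delta] in the roots [x_i1, ..., x_ir] of
    [W_i], the Schur polynomial of [la] is a determinant of powers, linear in
    its first row [x_ij^(la_1 + r_i - 1)]. The exponent is at least [s_i], so
    modulo [I_ab] the relation at [x_ij] replaces [x_ij^(s_i)] by a combination
    of other powers whose coefficients are products of elementary symmetric
    polynomials at the neighbours of [i]. Each resulting determinant has its
    first exponent equal to that of some [la + {t}] lowered by [s_i], and
    sorting the exponents is exactly the removal of a rim hook of length
    [s_i]. *)

Require Import Defs.
From mathcomp Require Import all_boot all_order all_algebra all_fingroup.
From mathcomp Require Import reals complex.
From mathcomp Require Import mpoly zify ring.
Import GRing.Theory Num.Theory.
Local Open Scope ring_scope.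

Set Implicit Arguments.
Unset Strict Implicit.
Unset Printing Implicit Defensive.

(** * Alternants under changes of the exponent vector *)

Definition set_first n (e : nat) (al : 'I_n -> nat) (k : 'I_n) : nat :=
  if k == 0%N :> nat then e else al k.

Section Alternants.
Variables (K : idomainType) (n : nat).

Lemma eq_alternant (al be : 'I_n -> nat) : al =1 be -> alternant K al = alternant K be.
Proof.
by move=> e; congr (\det _); apply/matrixP => k j; rewrite !mxE e.
Qed.

(** Cofactors along the first row do not see the first exponent, so one family [C] serves every [e];
    a relation between powers of ['X_j] then becomes one between alternants. *)
Lemma alternant_first_row (al : 'I_n -> nat) : (0 < n)%N ->
  exists C : 'I_n -> {mpoly K[n]},
    forall e, alternant K (set_first e al) = \sum_j 'X_j ^+ e * C j.
Proof.
move=> n_gt0; pose i0 := Ordinal n_gt0.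
pose A e : 'M[{mpoly K[n]}]_n := \matrix_(k, j) 'X_j ^+ set_first e al k.
exists (fun j => cofactor (A 0%N) i0 j) => e.
rewrite /alternant (expand_det_row _ i0); apply: eq_bigr => j _.
rewrite mxE /cofactor; congr (_ * (_ * \det _)).
by apply/matrixP => k l; rewrite !mxE /set_first.
Qed.

Lemma alternant_eq0 (al : 'I_n -> nat) k l : k != l -> al k = al l -> alternant K al = 0.
Proof.
by move=> nkl e; apply: (determinant_alternate nkl) => j; rewrite !mxE e.
Qed.

Lemma alternant_move (al be : nat -> nat) h : (h < n)%N ->
    (forall k, (k < n)%N -> be k =
       if (k < h)%N then al k.+1 else if k == h then al 0%N else al k) ->
  alternant K (fun k : 'I_n => al k) = (-1) ^+ h * alternant K (fun k : 'I_n => be k).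
Proof.
case: n => // m ltk beE.
(* The cycle that sends row [0] to row [h] and keeps the other rows in order has sign
   [(-1) ^+ h]. *)
pose s : 'S_m.+1 := lift_perm 0 (Ordinal ltk) 1.
have -> : (-1) ^+ h = (-1) ^+ (s : bool) :> {mpoly K[m.+1]}.
  by rewrite odd_lift_perm odd_perm1 addbF addFb signr_odd.
rewrite -det_perm -det_mulmx -row_permE; congr (\det _).
apply/matrixP => k j; rewrite !mxE beE //.
case: (unliftP 0 k) => [k'|] ->; last by rewrite lift_perm_id /= ltnn eqxx.
rewrite /s lift_perm_lift perm1 /= /bump leq0n add1n.
case: (leqP h k') => hk; last by rewrite add0n hk.
by rewrite add1n ltnNge (leqW hk) /= gtn_eqF.
Qed.

End Alternants.

(** * Row lengths after removal of a rim hook *)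

Section RimHookCombinatorics.
Local Open Scope nat_scope.
Implicit Types (la : seq nat) (b : nat * nat).

Lemma nth_part_gt0 la i : is_part la -> (0 < nth 0 la i) = (i < size la).
Proof.
move=> /andP[_ la0]; case: (ltnP i (size la)) => [lt|ge]; last by rewrite nth_default.
by rewrite lt0n; apply: contraNneq la0 => <-; apply: mem_nth.
Qed.

Lemma head_part_gt0 la : is_part la -> (0 < head 0 la) = (0 < size la).
Proof. by rewrite -nth0; apply: nth_part_gt0. Qed.

(** Each step, down or left, lowers the content (column minus row) by one. The rim has
    [head 0 la + size la - 1] boxes, and the walk stalls only at the last of them, the foot of the
    first column. *)
Lemma rim_walk_step la m : is_part la -> m.+1 < head 0 la + size la ->
  let b := iter m (rim_step la) (first_row_end la) in
  on_rim la b /\ b.2 + m.+1 = b.1 + head 0 la.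
Proof.
move=> pla; elim: m => [|m IH] ltm /=.
  have := head_part_gt0 pla; have := nth_part pla (leqnSn 0).
  rewrite /on_rim /in_diagram /= !nth0.
  by case: (la) ltm => //= a l; lia.
have [] := IH (ltnW ltm); move: (iter m _ _) => [i j].
rewrite /rim_step /on_rim /in_diagram /= => /andP[ij nij] e.
have := nth_part_gt0 i.+1 pla; have := nth_part_gt0 i pla.
have := nth_part pla (leqnSn i); have := nth_part pla (leqnSn i.+1).
by case: ifP => /=; lia.
Qed.

(* Rim boxes are determined by their content, and each step of the walk lowers
   the content by one. *)
Lemma mem_rim_walk la N b : is_part la -> N < head 0 la + size la ->
  (b \in rim_walk la N) = on_rim la b && (head 0 la + b.1 <= b.2 + N).
Proof.
move=> pla ltN; apply/trajectP/andP => [[m ltm ->]|[rb cb]].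
  have [] := rim_walk_step pla (leq_ltn_trans ltm ltN).
  by move: (iter m _ _) => c rc e; split=> //; lia.
move: (rb); rewrite {1}/on_rim /in_diagram => /andP[b1 _].
have lb0 := nth_part pla (leq0n b.1); rewrite nth0 in lb0.
have [m em] : exists m, b.2 + m.+1 = b.1 + head 0 la.
  by exists (b.1 + head 0 la - b.2.+1); lia.
have ltm : m < N by lia.
exists m => //.
have [] := rim_walk_step pla (leq_ltn_trans ltm ltN).
move: (iter m _ _) => c rc ec.
have e : b.2 + c.1 = c.2 + b.1 by lia.
have uniq_content x y : on_rim la x -> on_rim la y -> x.1 < y.1 ->
    x.2 + y.1 = y.2 + x.1 -> False.
  rewrite /on_rim /in_diagram /= => /andP[_ nx] /andP[y1 _] lt exy.
  have := nth_part pla lt; lia.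
case: (ltngtP b.1 c.1) => [lt|lt|e1].
- by case: (uniq_content _ _ rb rc lt); lia.
- by case: (uniq_content _ _ rc rb lt); lia.
by rewrite [b]surjective_pairing [c]surjective_pairing e1; congr pair; lia.
Qed.

Lemma rim_walk_is_hook la N : is_part la -> 0 < N ->
  is_rim_hook la N (rim_walk la N) = (N < head 0 la + size la).
Proof.
move=> pla N_gt0; case: ltnP => [ltN|geN]; last first.
  apply/negP => /and5P[_ /eqP hd uq _ rim].
  have la_gt0 : 0 < size la.
    move: hd rim; case: (rim_walk la N) => // b p [->] /= /andP[].
    by rewrite /on_rim /in_diagram /first_row_end /=; case: (la) => //=.
  have hla : 0 < head 0 la by rewrite head_part_gt0.
  (* The index at which the walk reaches the foot of the first column; the next step repeats that
     box, against [uniq]. *)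
  pose m := head 0 la + size la - 2.
  have ltm : m.+1 < N by rewrite /m; lia.
  have [] := @rim_walk_step la m pla; first by rewrite /m; lia.
  have ltm' := ltnW ltm.
  have : nth (first_row_end la) (rim_walk la N) m == nth (first_row_end la) (rim_walk la N) m.+1 = false.
    by rewrite nth_uniq ?size_traject // ltn_eqF.
  rewrite /rim_walk !nth_traject // iterS.
  move: (iter m _ _) => [i j]; rewrite /rim_step /on_rim /in_diagram /=.
  move=> ne /andP[ij nij] e.
  have := nth_part_gt0 i pla; have := nth_part_gt0 i.+1 pla.
  move: ne; case: ifP => /=; rewrite xpair_eqE ?eqxx /=; rewrite /m in e; lia.
have memW := fun b => mem_rim_walk b pla ltN.
apply/and5P; split.
- by rewrite size_traject.
- by case: (N) N_gt0.
(* Contents tell the boxes apart: [head 0 la] minus the content runs through [1, ..., N] along the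
   walk. *)
- apply: (@map_uniq _ _ (fun b => b.1 + head 0 la - b.2)).
  suff -> : map (fun b => b.1 + head 0 la - b.2) (rim_walk la N) = iota 1 N.
    exact: iota_uniq.
  apply: (@eq_from_nth _ 0) => [|m]; rewrite size_map size_traject ?size_iota //.
  move=> ltm; rewrite (nth_map (first_row_end la)) ?size_traject // nth_iota // /rim_walk nth_traject //.
  by have [_] := rim_walk_step pla (leq_ltn_trans ltm ltN); lia.
- apply/(sortedP (first_row_end la)) => m; rewrite size_traject => ltm.
  rewrite /rim_walk !nth_traject // 1?ltnW //.
  have [_] := rim_walk_step pla (leq_ltn_trans (ltnW ltm) ltN).
  have [_] := rim_walk_step pla (leq_ltn_trans ltm ltN).
  rewrite iterS; move: (iter m _ _) => [i j]; rewrite /adjacent /rim_step /=.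
  by case: ifP => _ /= e1 e2; apply/orP; [right | left]; rewrite eqxx /=; lia.
by apply/allP => b; rewrite memW => /andP[].
Qed.

(** The number of boxes of row [i] outside the walk. The walk takes the columns from the [maxn] on:
    its first argument is where the rim starts in this row, its second is the lower bound on
    contents. The [minn] covers rows that the walk misses. *)
Definition trimmed_row la N i : nat :=
  minn (nth 0 la i) (maxn (nth 0 la i.+1).-1 (head 0 la + i - N)).

Lemma notin_rim_walk la N i j : is_part la -> N < head 0 la + size la ->
  j < nth 0 la i -> ((i, j) \notin rim_walk la N) = (j < trimmed_row la N i).
Proof.
move=> pla ltN ltj.
by rewrite mem_rim_walk // /on_rim /in_diagram /= ltj /= /trimmed_row; lia.
Qed.

Lemma count_ltn_iota t n : t <= n -> count (fun j => j < t) (iota 0 n) = t.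
Proof.
move=> le; rewrite -{1}(subnKC le) iotaD count_cat add0n.
rewrite (@eq_in_count _ _ predT) => [|j]; last by rewrite mem_iota /= add0n => ->.
rewrite count_predT size_iota (@eq_in_count _ _ pred0) ?count_pred0 ?addn0 // => j.
by rewrite mem_iota /= => /andP[? _]; rewrite ltnNge; apply/negbF.
Qed.

Lemma remove_boxes_rim_walk la N : is_part la -> N < head 0 la + size la ->
  remove_boxes la (rim_walk la N) =
    [seq m <- [seq trimmed_row la N i | i <- iota 0 (size la)] | 0 < m].
Proof.
move=> pla ltN; congr filter; apply: eq_map => i.
rewrite (@eq_in_count _ _ (fun j => j < trimmed_row la N i)) => [|j].
  by rewrite count_ltn_iota // geq_minl.
by rewrite mem_iota /= add0n => ltj; rewrite notin_rim_walk.
Qed.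

(** The zeros of a weakly decreasing list are trailing, so dropping them is invisible to [nth] with
    default [0]. *)
Lemma nth_filter_gt0 s i : sorted geq s -> nth 0 [seq m <- s | 0 < m] i = nth 0 s i.
Proof.
elim: s i => [|a s IH] i //= ps.
have srt := path_sorted ps.
case: ltnP => [_|]; first by case: i => //= i; rewrite IH.
rewrite leqn0 => /eqP a0; move: ps; rewrite a0 path_sortedE; last first.
  by move=> y x z /= yx zy; apply: leq_trans zy yx.
move=> /andP[/allP s0 _]; rewrite IH // -[RHS]/(nth 0 (0 :: s) i).
have {}s0 j : nth 0 s j = 0.
  case: (ltnP j (size s)) => [lt|ge]; last by rewrite nth_default.
  by have := s0 _ (mem_nth 0 lt); rewrite /= leqn0 => /eqP.
by case: i => [|i] /=; rewrite s0.
Qed.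

Lemma sorted_trimmed_rows la N : (forall i, trimmed_row la N i.+1 <= trimmed_row la N i) ->
  sorted geq [seq trimmed_row la N i | i <- iota 0 (size la)].
Proof.
move=> dec; apply/(sortedP 0) => m; rewrite size_map size_iota => ltm.
by rewrite !(nth_map 0) ?size_iota // 1?ltnW // !nth_iota // 1?ltnW // !add0n; apply: dec.
Qed.

Lemma nth_remove_boxes la N i : is_part la -> N < head 0 la + size la ->
    (forall j, trimmed_row la N j.+1 <= trimmed_row la N j) ->
  nth 0 (remove_boxes la (rim_walk la N)) i = trimmed_row la N i.
Proof.
move=> pla ltN dec; rewrite remove_boxes_rim_walk // nth_filter_gt0.
  case: (ltnP i (size la)) => [lt|ge].
    by rewrite (nth_map 0) ?size_iota // nth_iota.
  by rewrite nth_default ?size_map ?size_iota // /trimmed_row (nth_default _ ge) min0n.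
exact: sorted_trimmed_rows.
Qed.

Lemma rim_removal_existsE la N : is_part la -> 0 < N -> N < head 0 la + size la ->
  reflect (forall i, trimmed_row la N i.+1 <= trimmed_row la N i)
          (rim_removal_exists la N).
Proof.
move=> pla N_gt0 ltN; rewrite /rim_removal_exists rim_walk_is_hook // ltN /=.
set mu := remove_boxes _ _.
have dg b : b \in boxes la -> b.2 < nth 0 la b.1 by move=> /allpairsPdep[i [j]]; rewrite !mem_iota /= => -[_ ? ->].
have gd b : b.2 < nth 0 la b.1 -> b \in boxes la.
  move=> lt; apply/allpairsPdep; exists b.1, b.2; rewrite -surjective_pairing.
  by rewrite !mem_iota /= !add0n lt -nth_part_gt0 // (leq_ltn_trans _ lt).
apply: (iffP andP) => [[pmu /allP muP] i|dec].
  have muE j k : k < nth 0 la j -> (k < nth 0 mu j) = (k < trimmed_row la N j).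
    by move=> lt; rewrite -notin_rim_walk //; have /eqP := muP (j, k) (gd (j, k) lt); rewrite /in_diagram /=.
  (* If row [i.+1] kept more boxes than row [i], the box [(i.+1, t)] would remain while [(i, t)]
     above it is removed, which is impossible for a partition [mu]. *)
  rewrite leqNgt; apply/negP => lt; set t := trimmed_row la N i in lt.
  have le1 : trimmed_row la N i.+1 <= nth 0 la i.+1 by apply: geq_minl.
  have le2 := nth_part pla (leqnSn i).
  have le3 := nth_part pmu (leqnSn i).
  have := muE i.+1 t (leq_trans lt le1); rewrite lt => lt4.
  have := muE i t (leq_trans (leq_trans lt le1) le2).
  by rewrite ltnn (leq_trans lt4 le3).
have muE i : nth 0 mu i = trimmed_row la N i by apply: nth_remove_boxes.
split.
  rewrite /mu remove_boxes_rim_walk // /is_part mem_filter ltnn andbT.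
  apply: sorted_filter (sorted_trimmed_rows dec).
  by move=> y x z /= yx zy; apply: leq_trans zy yx.
by apply/allP => b /dg bla; rewrite /in_diagram muE -notin_rim_walk -?surjective_pairing.
Qed.

Lemma size_remove_boxes la p : size (remove_boxes la p) <= size la.
Proof.
by rewrite /remove_boxes size_filter (leq_trans (count_size _ _)) // size_map size_iota.
Qed.

(** The inequality says that the last box of row [i] has content large enough for the walk. Contents
    of row ends strictly decrease downwards, so these rows form an initial segment, and row [0] is
    one of them. *)
Lemma last_hook_row la N : is_part la -> 0 < N -> 0 < size la ->
  exists2 h, h < size la &
    forall i, i < size la -> (head 0 la + i < nth 0 la i + N) = (i <= h).
Proof.
move=> pla N_gt0 la_gt0; pose P i := nth 0 la i + N <= head 0 la + i.
pose h := find P (iota 0 (size la)).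
have le_h : h <= size la by have := find_size P (iota 0 (size la)); rewrite size_iota.
have hP i : i < size la -> P i = (h <= i).
  move=> lti; case: (leqP h i) => [lehi|ltih]; last first.
    by have := before_find 0 ltih; rewrite nth_iota // add0n.
  have lth := leq_ltn_trans lehi lti.
  have := nth_find 0 (_ : has P (iota 0 (size la))).
  rewrite has_find size_iota => /(_ lth); rewrite -/h nth_iota // add0n /P.
  by have := nth_part pla lehi; lia.
have h_gt0 : 0 < h by rewrite ltnNge -hP // /P -nth0; lia.
exists h.-1; first by rewrite prednK.
by move=> i lti; rewrite -[i <= _]ltnS prednK // [RHS]ltnNge -hP // /P ltnNge.
Qed.

Lemma hook_height_rim_walk la N h : is_part la -> N < head 0 la + size la ->
    h < size la ->
    (forall i, i < size la -> (head 0 la + i < nth 0 la i + N) = (i <= h)) ->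
  hook_height (rim_walk la N) = h.+1.
Proof.
move=> pla ltN lth hP; rewrite /hook_height -[RHS](size_iota 0); apply: perm_size.
apply: uniq_perm; rewrite ?undup_uniq ?iota_uniq // => i.
rewrite mem_undup mem_iota /= add0n ltnS; apply/mapP/idP => [[[k j] + ->]|le].
  rewrite mem_rim_walk // /on_rim /in_diagram /= => /andP[/andP[ltj _] cj].
  by rewrite -hP -?nth_part_gt0 //; lia.
have lti := leq_ltn_trans le lth.
exists (i, (nth 0 la i).-1) => //; rewrite mem_rim_walk // /on_rim /in_diagram /=.
have := hP i lti; have := nth_part pla (leqnSn i); have := nth_part_gt0 i pla.
by rewrite lti le; lia.
Qed.

(** Once the staircase is added, this is the cyclic move of [alternant_move]: the exponents of rows
    [1, ..., h] move up one row, and the first exponent, lowered by [N], lands in row [h]. *)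
Lemma trimmed_rowE la N h i : is_part la -> N < head 0 la + size la ->
    h < size la ->
    (forall i, i < size la -> (head 0 la + i < nth 0 la i + N) = (i <= h)) ->
  trimmed_row la N i =
    if i < h then (nth 0 la i.+1).-1
    else if i == h then head 0 la + h - N else nth 0 la i.
Proof.
move=> pla ltN lth hP; rewrite /trimmed_row.
have p := fun i => nth_part_gt0 i pla; have := p i; have := p i.+1; have := p h.+1.
have := nth_part pla (leqnSn i); have := hP i; have := hP i.+1; have := hP _ lth.
have := nth_part pla (leqnSn h).
case: (ltngtP i h) => [lt|gt|->] /=; last by lia.
  by rewrite (leq_ltn_trans lt lth) (ltn_trans lt lth); lia.
by case: (ltnP i (size la)) => // _; lia.
Qed.

End RimHookCombinatorics.

(* Both sides vanish when the shortened first exponent collides with another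
   one; otherwise sorting the exponents moves it down to the last row of the
   rim hook. *)
Lemma alternant_RH (K : idomainType) n la N : is_part la -> la != [::] ->
    (size la <= n)%N -> (0 < N)%N -> (N <= head 0%N la + n.-1)%N ->
  RH N (schur K n) la * alternant K (@staircase n) =
    alternant K (set_first (head 0%N la + n.-1 - N) (@shifted n la)).
Proof.
move=> pla la_neq0 le_n N_gt0 leN.
have la_gt0 : (0 < size la)%N by rewrite lt0n size_eq0.
have n_gt0 := leq_trans la_gt0 le_n.
pose al k := if k == 0%N then (head 0 la + n.-1 - N)%N
             else (nth 0 la k + (n - k.+1))%N.
have alE : alternant K (set_first (head 0%N la + n.-1 - N) (@shifted n la)) =
           alternant K (fun k : 'I_n => al k) by apply: eq_alternant.
have collision k : (0 < k < n)%N -> (N + nth 0 la k)%N = (head 0 la + k)%N ->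
    alternant K (fun k : 'I_n => al k) = 0.
  case/andP => k_gt0 ltk e.
  apply: (@alternant_eq0 _ _ _ (Ordinal n_gt0) (Ordinal ltk)).
    by rewrite -val_eqE /= eq_sym -lt0n.
  by rewrite /al /= -[k == 0%N]negbK -lt0n k_gt0 /= -nth0; rewrite -nth0 in e leN; lia.
rewrite alE /RH; case: (ltnP N (head 0%N la + size la)) => [ltN|geN]; last first.
  rewrite {1}/rim_removal_exists rim_walk_is_hook // ltnNge geN /= mul0r.
  (* The rim is too short, and the lowered first exponent equals that of the empty row
     [N - head 0 la]. *)
  rewrite (collision (N - head 0 la)%N) //; first by lia.
  by rewrite nth_default; lia.
have [h lth hP] := last_hook_row pla N_gt0 la_gt0.
have tE := fun i => trimmed_rowE i pla ltN lth hP.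
have lthn := leq_trans lth le_n.
have pos := fun i => nth_part_gt0 i pla.
have hP1 := hP h.+1; have hP0 := hP _ lth; have pos1 := pos h.+1.
case: rim_removal_existsE => // [dec|ndec]; last first.
  (* The trimmed rows can only fail to decrease from row [h] to row [h.+1], and then by exactly one
     box, which is the collision with row [h.+1]. *)
  rewrite mul0r; have [e|ne] := eqVneq (N + nth 0%N la h.+1)%N (head 0%N la + h.+1)%N.
    by rewrite (collision h.+1) //; case: (ltnP h.+1 (size la)) pos1 hP1 ltN; lia.
  case: ndec => i; rewrite !tE.
  have := nth_part pla (leqnSn i); have := nth_part pla (leqnSn i.+1).
  have := hP i.+1; have := pos i.+1.
  case: (ltngtP i.+1 h) => [lt|gt|e] /=; first by lia.
    by case: eqVneq => [e|_] /=; [subst i; lia | lia].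
  by subst h; rewrite ltnSn in hP0; lia.
rewrite (hook_height_rim_walk pla ltN lth hP) -mulrA schurP; last first.
  exact: leq_trans (size_remove_boxes _ _) le_n.
rewrite !exprS mulrA mulrNN !mul1r.
pose be k := (nth 0 (remove_boxes la (rim_walk la N)) k + (n - k.+1))%N.
rewrite (@alternant_move K n al be h) // => k ltk.
rewrite /be nth_remove_boxes // tE /al.
case: (ltngtP k h) => [lt|gt|->] /=.
- by have := pos k.+1; rewrite (leq_ltn_trans lt lth); lia.
- by rewrite ifF //; lia.
(* The subtraction in [head 0 la + h - N] is not truncated: either row [h.+1] is nonempty and ends
   outside the hook, or [h] is the last row and [ltN] applies. *)
by move: hP1 pos1; case: (ltnP h.+1 (size la)); lia.
Qed.

(** * Column Schur polynomials and Vieta's formula *)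

Lemma horner_prod_XsubC_eq0 (A : comNzRingType) n (a : 'I_n -> A) j :
  (\prod_(k < n) ('X - (a k)%:P)).[a j] = 0.
Proof. by rewrite horner_prod (bigD1 j) //= hornerXsubC subrr mul0r. Qed.

Section ElementarySchur.
Variables (K : idomainType) (n : nat).

Lemma schur_nil : schur K n [::] = 1.
Proof.
apply: (mulIf (staircase_neq0 K n)); rewrite schurP // mul1r.
by apply: eq_alternant => k; rewrite /shifted nth_nil.
Qed.

(* Reducing the first exponent [n] of the numerator of [schur (nseq k 1)] with
   [rootP], only the term of degree [n - k] does not repeat a row. *)
Lemma schur_column (c : nat -> {mpoly K[n]}) k :
    (forall j, 'X_j ^+ n = - \sum_(l < n) c l * 'X_j ^+ l) -> (0 < k <= n)%N ->
  schur K n (nseq k 1%N) = (-1) ^+ k * c (n - k)%N.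
Proof.
case: k => // k rootP /= ltk.
have n_gt0 : (0 < n)%N by apply: leq_trans ltk.
apply: (mulIf (staircase_neq0 K n)); rewrite schurP; last by rewrite /= size_nseq.
set al := shifted _.
have nthE m : nth 0%N (nseq k.+1 1%N) m = (m < k.+1)%N by rewrite nth_nseq; case: ifP.
have -> : alternant K al = alternant K (set_first n al).
  apply: eq_alternant => m; rewrite /set_first; case: eqP => // m0.
  by rewrite /al /shifted nthE m0 /staircase m0 ltnS leq0n; lia.
have [C CE] := alternant_first_row K al n_gt0.
rewrite CE (eq_bigr (fun j => - \sum_(l < n) c l * ('X_j ^+ l * C j))); last first.
  move=> j _; rewrite rootP mulNr mulr_suml; congr (- _); apply: eq_bigr => l _.
  by rewrite mulrA.
rewrite sumrN exchange_big /=.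
rewrite (eq_bigr (fun l : 'I_n => c l * alternant K (set_first l al))); last first.
  by move=> l _; rewrite CE mulr_sumr.
have ltl : (n - k.+1 < n)%N by lia.
rewrite (bigD1 (Ordinal ltl)) //= [X in _ + X]big1 ?addr0 => [|l]; last first.
  rewrite -val_eqE /= => nel; have lt := ltn_ord l.
  (* Below the first row the exponents are all the numbers less than [n] except [n - k.+1]. *)
  have [m /andP[m_gt0 ltm] lE] :
      exists2 m, (0 < m < n)%N & l = ((m < k.+1) + (n - m.+1))%N :> nat.
    case: (ltnP (n - k.+1) l) => [gt|le]; [exists (n - l)%N | exists (n - l.+1)%N]; lia.
  rewrite (@alternant_eq0 _ _ _ (Ordinal n_gt0) (Ordinal ltm)) ?mulr0 //.
    by rewrite -val_eqE /= eq_sym -lt0n.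
  by rewrite /set_first /= /al /shifted nthE /= gtn_eqF.
pose al' m := if m == 0%N then (n - k.+1)%N else ((m < k.+1) + (n - m.+1))%N.
have -> : alternant K (set_first (n - k.+1) al) = alternant K (fun m : 'I_n => al' m).
  by apply: eq_alternant => m; rewrite /set_first /al' /al /shifted nthE.
rewrite (@alternant_move _ n al' (fun m => n - m.+1)%N k) // => [|m ltm]; last first.
  rewrite /al'; case: (ltngtP m k) => [lt|gt|->] //=.
    by rewrite ltnS lt; lia.
  by rewrite ifF; lia.
move: (c _) (alternant _ _) => x y.
by rewrite exprS !mulN1r !mulNr mulrCA mulrA.
Qed.

(** Vieta's formula: the column Schur polynomials are the elementary symmetric ones. The product
    vanishes at each ['X_j], so its coefficients can serve as the [c] of [schur_column]. *)
Lemma prod_XsubC_schur :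
  \prod_(j < n) ('X - ('X_j)%:P) =
    \sum_(k < n.+1) ((-1) ^+ k * schur K n (nseq k 1%N)) *: 'X^(n - k)
      :> {poly {mpoly K[n]}}.
Proof.
set P := \prod_(j < n) _.
have monP : P \is monic by apply: monic_prod => j _; apply: monicXsubC.
have szP : size P = n.+1 by rewrite size_prod_XsubC /index_enum -enumT size_enum_ord.
have Pn : P`_n = 1 by have := monicP monP; rewrite lead_coefE szP.
have rootP (j : 'I_n) : 'X_j ^+ n = - \sum_(l < n) P`_l * 'X_j ^+ l :> {mpoly K[n]}.
  have : P.['X_j] = 0 by apply: (horner_prod_XsubC_eq0 (fun k : 'I_n => 'X_k)).
  by rewrite horner_coef szP big_ord_recr /= Pn mul1r addrC => /eqP; rewrite addr_eq0 => /eqP.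
rewrite -[LHS]coefK poly_def szP (reindex_inj rev_ord_inj) /=.
apply: eq_bigr => -[k ltk] _ /=; rewrite subSS; congr (_ *: _).
case: k ltk => [|k] ltk; first by rewrite subn0 Pn schur_nil expr0 mulr1.
by rewrite (schur_column rootP) // mulrA -expr2 sqrr_sign mul1r.
Qed.

End ElementarySchur.

Lemma prod_addX_schur (K : idomainType) n (A : comNzRingType)
    (phi : {rmorphism {mpoly K[n]} -> A}) (u : A) :
  \prod_(j < n) (phi 'X_j + u) =
    \sum_(k < n.+1) phi (schur K n (nseq k 1%N)) * u ^+ (n - k).
Proof.
have := congr1 (fun p => (-1) ^+ n * (map_poly phi p).[- u]) (prod_XsubC_schur K n).
rewrite rmorph_prod horner_prod -[n in (-1) ^+ n]card_ord -prodr_const -big_split /=.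
rewrite (eq_bigr (fun j => phi 'X_j + u)) => [->|j _]; last first.
  by rewrite rmorphB /= map_polyX map_polyC hornerXsubC mulN1r opprB opprK.
rewrite rmorph_sum horner_sum prodr_const card_ord mulr_sumr.
apply: eq_bigr => -[k ltk] _ /=.
rewrite linearZ /= map_polyXn hornerZ hornerXn rmorphM rmorph_sign [(- u) ^+ _]exprNn.
have -> : (-1) ^+ n = (-1) ^+ k * (-1) ^+ (n - k) :> A by rewrite -exprD subnKC.
have e a : (-1) ^+ a * (-1) ^+ a = 1 :> A by rewrite -expr2 sqrr_sign.
have := e k; have := e (n - k)%N.
move: (phi _) ((-1) ^+ k) ((-1) ^+ _) (u ^+ _) => y v w z ew ev.
transitivity ((v * v) * (w * w) * (y * z)); first by ring.
by rewrite ev ew !mul1r.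
Qed.

(** * Products of sums, grouped by total weight *)

Section SumOverWeights.
Variables (A : comNzRingType) (I : finType).

Lemma prod_sum_dffun (T_ : I -> finType) (F : forall a, T_ a -> A) :
  \prod_a \sum_(k : T_ a) F a k =
    \sum_(f : {dffun forall a, T_ a}) \prod_a F a (f a).
Proof.
pose G a : {ffun T_ a -> A} := [ffun k => F a k].
(* Distributivity is available for functions into one common type, here the tagged union of the
   [T_ a], so dependent functions are first recoded as [fprod]. *)
rewrite (reindex (@dffun_of_fprod _ T_)) /=; last exact/onW_bij/dffun_of_fprod_bij.
transitivity (\sum_(t : fprod T_) \prod_(a in I) G a (t a)); last first.
  by apply: eq_bigr => t _; apply: eq_bigr => a _; rewrite !ffunE.
rewrite big_fprod.
rewrite (eq_bigr (fun a => \sum_(u in tagged_with T_ a) untag 0 (G a) u)) => [|a _].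
  by rewrite bigA_distr_big_dep.
rewrite -(big_tag (fun a => G a)); apply: eq_bigr => k _; rewrite ffunE //.
Qed.

Lemma prod_sum_weight (m : I -> nat) (c : I -> nat -> A) (u : A) :
  \prod_a \sum_(k < (m a).+1) c a k * u ^+ (m a - k) =
    \sum_(0 <= k < (\sum_a m a).+1)
      \sum_(f : {dffun forall a, 'I_(m a).+1} | (\sum_a f a)%N == k)
        (\prod_a c a (f a)) * u ^+ (\sum_a m a - k).
Proof.
rewrite (prod_sum_dffun (fun a (k : 'I_(m a).+1) => c a k * u ^+ (m a - k))).
have le (f : {dffun forall a, 'I_(m a).+1}) : (\sum_a f a <= \sum_a m a)%N.
  by apply: leq_sum => a _; rewrite -ltnS.
rewrite big_mkord (partition_big (fun f : {dffun forall a, 'I_(m a).+1} =>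
  inord (\sum_a f a) : 'I_(\sum_a m a).+1) predT) //=.
apply: eq_bigr => k _; apply: eq_big => [f|f /eqP <-].
  by rewrite -val_eqE /= inordK ?ltnS.
rewrite big_split prodrXr inordK ?ltnS //; congr (_ * _ ^+ _).
by rewrite sumnB // => a _; rewrite -ltnS.
Qed.

End SumOverWeights.

Lemma rmorph_RH (A B : pzRingType) (phi : {rmorphism A -> B}) n s la :
  phi (RH n s la) = RH n (fun mu => phi (s mu)) la.
Proof.
by rewrite /RH; case: ifP => _; rewrite ?rmorph0 // rmorphM rmorph_sign.
Qed.

(** * The abelian relations and [omega] through Schur polynomials at the vertices *)

Section QuiverFlagRing.
Variables (Q : quiver) (r : vertex Q -> nat) (K : idomainType).
Implicit Types i j : vertex Q.

Local Notation P := {mpoly K[#|var r|]}.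

(** A lift of [sQ] to the invariant ring, with the same convention at the source, so that identities
    can be checked on polynomials. *)
Definition s_inv i (la : seq nat) : inv_ring r K :=
  if i == ord0 then (la == [::])%:R else InvRing (schur_x_inv r K i la).

Lemma QH_class_s_inv i la : QH_class (s_inv i la) = sQ r K i la.
Proof. by rewrite /s_inv /sQ; case: ifP => // _; rewrite /QH_class rmorph_nat. Qed.

Definition s_val i (la : seq nat) : P := \val (s_inv i la).

Lemma s_valE i : i != ord0 -> s_val i = schur_x r K i.
Proof. by move=> /negPf i0; apply/boolp.funext => la; rewrite /s_val /s_inv i0. Qed.

Lemma s_val_source i la : i = ord0 -> s_val i la = (la == [::])%:R.
Proof. by move=> ->; rewrite /s_val /s_inv eqxx rmorph_nat. Qed.

Local Notation at_roots i := (comp_mpoly [tuple x_root K j | j < r i]).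

Lemma at_rootsX i (j : 'I_(r i)) : at_roots i 'X_j = x_root K j.
Proof. by rewrite comp_mpolyXU -tnth_nth tnth_mktuple. Qed.

(* At the source the product is a power of [u], since [x_01 = 0]. *)
Lemma prod_x_root_add i (u : P) :
  \prod_(k < r i) (x_root K k + u) =
    \sum_(k < (r i).+1) s_val i (nseq k 1%N) * u ^+ (r i - k).
Proof.
have [i0|ni0] := eqVneq i ord0; last first.
  rewrite s_valE // -(prod_addX_schur (at_roots i)); apply: eq_bigr => k _.
  by rewrite /= at_rootsX.
rewrite (eq_bigr (fun=> u)) => [|k _]; last first.
  by rewrite /x_root insubF ?add0r //= i0 eqxx.
rewrite prodr_const card_ord big_ord_recl /= big1 ?addr0 => [|k _].
  by rewrite s_val_source // mul1r subn0.
by rewrite s_val_source // mul0r.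
Qed.

(** The classical half of the relation as a polynomial in [u]: Vieta's formula at each source of an
    arrow, after a sign is taken out of every factor. The term [k = 0] is the pure power of [u]. *)
Lemma prod_x_root_in i (u : P) :
  \prod_(a : arrow_into i) \prod_(k < r (src (val a))) (- x_root K k + u) =
    \sum_(0 <= k < (s_in r i).+1)
      \sum_(ka : {dffun forall a : arrow_into i, 'I_(r (src (val a))).+1}
             | (\sum_a ka a)%N == k)
        (-1) ^+ k * (\prod_a s_val (src (val a)) (nseq (ka a) 1%N)) * u ^+ (s_in r i - k).
Proof.
transitivity ((-1) ^+ s_in r i * \prod_(a : arrow_into i)
    \prod_(k < r (src (val a))) (x_root K k + - u)).
  rewrite /s_in -prodrXr -big_split; apply: eq_bigr => a _ /=.
  rewrite -[X in (-1) ^+ X]card_ord -prodr_const -big_split; apply: eq_bigr => k _ /=.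
  by rewrite mulN1r opprD opprK.
under [in LHS]eq_bigr do rewrite prod_x_root_add.
rewrite (prod_sum_weight (fun a : arrow_into i => r (src (val a)))
  (fun a k => s_val (src (val a)) (nseq k 1%N))).
rewrite mulr_sumr; apply: eq_big_nat => k /andP[_ lek].
rewrite mulr_sumr; apply: eq_bigr => ka _.
rewrite -/(s_in r i) [(- u) ^+ _]exprNn.
have -> : (-1) ^+ s_in r i = (-1) ^+ k * (-1) ^+ (s_in r i - k) :> P.
  by rewrite -exprD subnKC.
have : (-1) ^+ (s_in r i - k) * (-1) ^+ (s_in r i - k) = 1 :> P.
  by rewrite -expr2 sqrr_sign.
move: ((-1) ^+ k) ((-1) ^+ _) (u ^+ _) (\prod_a _) => w v z y ev.
by transitivity ((v * v) * (w * y * z)); [ring | rewrite ev mul1r].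
Qed.

Lemma prod_x_root_out i (u : P) :
  \prod_(a : arrow_from i) \prod_(k < r (tgt (val a))) (- u + x_root K k) =
    \sum_(0 <= k < (s_out r i).+1)
      \sum_(ka : {dffun forall a : arrow_from i, 'I_(r (tgt (val a))).+1}
             | (\sum_a ka a)%N == k)
        (-1) ^+ (s_out r i - k)
        * (\prod_a s_val (tgt (val a)) (nseq (ka a) 1%N)) * u ^+ (s_out r i - k).
Proof.
under eq_bigr => a _ do under eq_bigr => k _ do rewrite addrC.
under [in LHS]eq_bigr do rewrite prod_x_root_add.
rewrite (prod_sum_weight (fun a : arrow_from i => r (tgt (val a)))
  (fun a k => s_val (tgt (val a)) (nseq k 1%N))).
apply: eq_bigr => k _; apply: eq_bigr => ka _.
by rewrite [(- u) ^+ _]exprNn mulrA [_ * (-1) ^+ _]mulrC.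
Qed.

Lemma staircase_omega i : exists b : bool,
  \prod_(j < r i) \prod_(k < r i | (j < k)%N) (x_root K j - x_root K k) =
    (-1) ^+ b * at_roots i (alternant K (@staircase (r i))).
Proof.
(* One sign per pair, from reversing the difference of roots, times the sign of reversing the rows
   of the Vandermonde matrix. *)
exists (odd (\sum_(j < r i) \sum_(k < r i | (j < k)%N) 1)
        (+) (perm (@rev_ord_inj (r i)) : bool)).
have -> : at_roots i (alternant K (@staircase (r i))) =
    \det (row_perm (perm (@rev_ord_inj (r i)))
                   (Vandermonde (r i) (\row_j x_root K j))).
  rewrite -det_map_mx; congr (\det _); apply/matrixP => k j.
  by rewrite !mxE permE rmorphXn /= at_rootsX.
rewrite row_permE det_mulmx det_perm det_Vandermonde signr_addb -mulrA signrMK signr_odd.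
rewrite -prodrXr -big_split; apply: eq_bigr => j _ /=.
rewrite -prodrXr -big_split; apply: eq_bigr => k _ /=.
by rewrite !mxE expr1 mulN1r opprB.
Qed.

Lemma omega_dvd i : i != ord0 ->
  exists w, omega r K = w * at_roots i (alternant K (@staircase (r i))).
Proof.
move=> i0; rewrite /omega (bigD1 i) //=; have [b ->] := staircase_omega i.
by rewrite mulrC mulrA; eexists.
Qed.

End QuiverFlagRing.

(** Summing over the roots first reassembles each power into a first-row expansion of an
    alternant. *)
Lemma sum_exchange_weights (A : comNzRingType) n (x C : 'I_n -> A) (T : finType)
    (p : nat -> pred T) N m (c : nat -> T -> A) (e : nat -> nat) :
  \sum_j x j ^+ m * C j * (\sum_(0 <= k < N) \sum_(f | p k f) c k f * x j ^+ e k) =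
    \sum_(0 <= k < N) \sum_(f | p k f) c k f * \sum_j x j ^+ (m + e k) * C j.
Proof.
under eq_bigr do rewrite mulr_sumr.
rewrite exchange_big; apply: eq_bigr => k _ /=.
under eq_bigr do rewrite mulr_sumr.
rewrite exchange_big; apply: eq_bigr => f _ /=.
by rewrite mulr_sumr; apply: eq_bigr => j _; rewrite exprD; ring.
Qed.

(** * The expansion modulo the abelian relations at one vertex *)

Section RimHookExpansion.
Variables (Q : quiver) (r : vertex Q -> nat) (i : vertex Q) (la : seq nat).

(** Stated over any commutative ring, so that ring morphisms carry it from polynomials and
    invariants to [QH]. *)
Definition rim_hook_expansion (A : comPzRingType) (q : A) (s : vertex Q -> seq nat -> A) : A :=
  (\sum_(1 <= k < (s_in r i).+1)
    \sum_(ka : {dffun forall a : arrow_into i, 'I_(r (src (val a))).+1}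
           | (\sum_a ka a)%N == k)
      (-1) ^+ k.+1
      * RH (s_in r i) (s i) (add_first la (s_in r i - k))
      * \prod_(a : arrow_into i) s (src (val a)) (nseq (ka a) 1%N))
  + (-1) ^+ (r i).-1 * q
    * (\sum_(0 <= k < (s_out r i).+1)
        \sum_(ka : {dffun forall a : arrow_from i, 'I_(r (tgt (val a))).+1}
               | (\sum_a ka a)%N == k)
          (-1) ^+ (s_out r i - k)
          * RH (s_in r i) (s i) (add_first la (s_out r i - k))
          * \prod_(a : arrow_from i) s (tgt (val a)) (nseq (ka a) 1%N)).

Lemma rmorph_rim_hook_expansion (A B : comPzRingType) (phi : {rmorphism A -> B}) q s :
  phi (rim_hook_expansion q s) = rim_hook_expansion (phi q) (fun j mu => phi (s j mu)).
Proof.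
rewrite /rim_hook_expansion rmorphD !rmorphM rmorph_sign !rmorph_sum.
congr (_ + _ * _); apply: eq_bigr => k _; rewrite rmorph_sum; apply: eq_bigr => ka _.
  by rewrite !rmorphM rmorph_sign rmorph_RH rmorph_prod.
by rewrite !rmorphM rmorph_sign rmorph_RH rmorph_prod.
Qed.

Variable K : idomainType.
Hypotheses (i_neq0 : i != ord0) (r_gt0 : (0 < r i)%N) (s_gt0 : (0 < s_in r i)%N).
Hypotheses (la_part : is_part la) (la_neq0 : la != [::]) (la_size : (size la <= r i)%N).
Hypothesis la_large : (s_in r i <= head 0%N la + (r i).-1)%N.

Local Notation at_roots := (comp_mpoly [tuple x_root K j | j < r i]).
Local Notation denom := (at_roots (alternant K (@staircase (r i)))).

(** The first exponent of [la] lowered by [s_in r i]; hence [m + t] is the lowered first exponent of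
    [la] with [t] added. *)
Let m := (head 0 la + (r i).-1 - s_in r i)%N.

Let alternant_RH_add t :
  at_roots (alternant K (set_first (m + t) (@shifted (r i) la))) =
    denom * RH (s_in r i) (s_val r K i) (add_first la t).
Proof.
rewrite s_valE // mulrC -(rmorph_RH at_roots) -rmorphM; congr (at_roots _).
case: la la_part la_neq0 la_size la_large @m => // a mu pmu _ /= smu large.
rewrite (@alternant_RH K (r i) ((a + t)%N :: mu) (s_in r i)) //=; last by lia.
  apply: eq_alternant => k; rewrite /set_first /shifted /=.
  by case: eqP => // [_|]; [lia | case: k => -[]].
move: pmu; rewrite /is_part /= !inE !negb_or => /andP[pth /andP[a0 mu0]].
rewrite mu0 andbT; apply/andP; split; last by lia.
by case: (mu) pth => //= b nu /andP[ba ->]; rewrite andbT; lia.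
Qed.

Let alternant_schur :
  at_roots (alternant K (set_first (m + s_in r i) (@shifted (r i) la))) =
    denom * s_val r K i la.
Proof.
rewrite s_valE // mulrC -rmorphM schurP //; congr (at_roots _).
apply: eq_alternant => k; rewrite /set_first; case: eqP => // k0.
by rewrite /m subnK // /shifted /staircase k0 nth0 subn1.
Qed.

Lemma schur_sub_rim_hook_expansion : exists c : 'I_(r i) -> {mpoly K[#|var r|]},
  denom * (s_val r K i la - rim_hook_expansion (q_par r K i) (s_val r K)) =
    \sum_j c j * ab_relation K j.
Proof.
have [C0 C0E] := alternant_first_row K (@shifted (r i) la) r_gt0.
pose C j := at_roots (C0 j).
have sumC t : \sum_j x_root K j ^+ (m + t) * C j =
    at_roots (alternant K (set_first (m + t) (@shifted (r i) la))).
  rewrite C0E rmorph_sum; apply: eq_bigr => j _ /=.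
  by rewrite rmorphM rmorphXn /= at_rootsX.
(* With these coefficients the leading power in the relation at [j] contributes the [j]-th term of
   the numerator of the Schur polynomial of [la]. *)
exists (fun j => x_root K j ^+ m * C j).
pose In := \sum_(1 <= k < (s_in r i).+1)
    \sum_(ka : {dffun forall a : arrow_into i, 'I_(r (src (val a))).+1}
           | (\sum_a ka a)%N == k)
      (-1) ^+ k.+1
      * RH (s_in r i) (s_val r K i) (add_first la (s_in r i - k))
      * \prod_(a : arrow_into i) s_val r K (src (val a)) (nseq (ka a) 1%N).
pose Out := \sum_(0 <= k < (s_out r i).+1)
        \sum_(ka : {dffun forall a : arrow_from i, 'I_(r (tgt (val a))).+1}
               | (\sum_a ka a)%N == k)
          (-1) ^+ (s_out r i - k)
          * RH (s_in r i) (s_val r K i) (add_first la (s_out r i - k))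
          * \prod_(a : arrow_from i) s_val r K (tgt (val a)) (nseq (ka a) 1%N).
have InE : \sum_j x_root K j ^+ m * C j *
    (\prod_(a : arrow_into i) \prod_(k < r (src (val a))) (- x_root K k + x_root K j))
    = denom * (s_val r K i la - In).
  under eq_bigr do rewrite prod_x_root_in.
  rewrite (sum_exchange_weights (fun j => x_root K j) C).
  (* The term [k = 0], where every [ka a] is zero, gives the Schur polynomial of [la]; the others
     give [In], with the sign changed by the subtraction. *)
  rewrite big_ltn // mulrBr; congr (_ + _).
    pose ka0 : {dffun forall a : arrow_into i, 'I_(r (src (val a))).+1} :=
      [ffun a => ord0].
    rewrite (big_pred1 ka0) => [|ka].
      rewrite big1 => [|a _]; last first.
        by rewrite ffunE /s_val /s_inv; case: ifP; rewrite ?rmorph1 //= /schur_x schur_nil rmorph1.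
      by rewrite expr0 mulr1 mul1r subn0 sumC alternant_schur.
    rewrite sum_nat_eq0; apply/forallP/eqP => [ka_0|-> a]; last by rewrite ffunE.
    by apply/ffunP => a; rewrite ffunE; apply/val_inj/eqP; apply: (ka_0 a).
  rewrite /In mulr_sumr -sumrN; apply: eq_bigr => k _.
  rewrite mulr_sumr -sumrN; apply: eq_bigr => ka _; rewrite sumC alternant_RH_add.
  by move: (RH _ _ _) denom (\prod_a _) => x y z; rewrite exprS; ring.
have OutE : \sum_j x_root K j ^+ m * C j *
    (\prod_(a : arrow_from i) \prod_(k < r (tgt (val a))) (- x_root K j + x_root K k))
    = denom * Out.
  under eq_bigr do rewrite prod_x_root_out.
  rewrite (sum_exchange_weights (fun j => x_root K j) C).
  rewrite /Out mulr_sumr; apply: eq_bigr => k _.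
  rewrite mulr_sumr; apply: eq_bigr => ka _; rewrite sumC alternant_RH_add.
  by move: (RH _ _ _) denom (\prod_a _) => x y z; ring.
rewrite /rim_hook_expansion -/In -/Out opprD addrA mulrDr -InE mulrN mulrCA -OutE.
rewrite mulr_sumr -sumrB; apply: eq_bigr => j _; rewrite /ab_relation.
by rewrite mulrBr; congr (_ - _); rewrite mulrCA.
Qed.

End RimHookExpansion.

(** * Passage to the quantum cohomology ring *)

Lemma omega_mul_in_I_ab (Q : quiver) (r : vertex Q -> nat) (K : idomainType)
    (i : vertex Q) (f : {mpoly K[#|var r|]}) (c : 'I_(r i) -> {mpoly K[#|var r|]}) :
    i != ord0 ->
    (alternant K (@staircase (r i)) \mPo [tuple x_root K j | j < r i]) * f =
      \sum_j c j * ab_relation K j ->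
  I_ab (omega r K * f).
Proof.
(* [omega] is a multiple of the denominator at [i], and [f] times that denominator is a combination
   of relations. *)
move=> i0 e; have [w ->] := omega_dvd r K i0; apply/ideal_predP.
rewrite -mulrA e ideal_predM // rpred_sum // => j _; apply: ideal_predM.
apply/ideal_predP; exists 1%N, (fun=> 1), (fun=> ab_relation K j).
by split=> [_|]; [exists i, j | rewrite big_ord1 mul1r].
Qed.

Theorem theorem3p7 (R : realType) (Q : quiver) (r : vertex Q -> nat)
    (r_source : r ord0 = 1%N)
    (r_pos : forall j, (0 < r j)%N)
    (r_lt_s : forall j, j != ord0 -> (r j < s_in r j)%N)
    (Q_reduced : graph_reduced r)
    (M_Fano : Fano r)
    (i : vertex Q) (i_neq0 : i != ord0)
    (la : seq nat) (la_part : is_part la)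
    (la_size : (size la <= r i)%N)
    (la_large : (s_in r i - r i + 1 <= head 0 la)%N) :
  sQ r (complex R) i la =
    (\sum_(1 <= k < (s_in r i).+1)
      \sum_(ka : {dffun forall a : arrow_into i, 'I_(r (src (val a))).+1}
             | (\sum_a ka a)%N == k)
        (-1) ^+ k.+1
        * RH (s_in r i) (sQ r (complex R) i) (add_first la (s_in r i - k))
        * \prod_(a : arrow_into i)
            sQ r (complex R) (src (val a)) (nseq (ka a) 1%N))
    + (-1) ^+ (r i).-1 * qQ r (complex R) i
      * (\sum_(0 <= k < (s_out r i).+1)
          \sum_(ka : {dffun forall a : arrow_from i, 'I_(r (tgt (val a))).+1}
                 | (\sum_a ka a)%N == k)
            (-1) ^+ (s_out r i - k)
            * RH (s_in r i) (sQ r (complex R) i) (add_first la (s_out r i - k))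
            * \prod_(a : arrow_from i)
                sQ r (complex R) (tgt (val a)) (nseq (ka a) 1%N)).
Proof.
have la_neq0 : la != [::] by case: (la) la_large => //=; lia.
have s_gt0 : (0 < s_in r i)%N by apply: leq_ltn_trans (r_lt_s _ i_neq0).
have la_large' : (s_in r i <= head 0%N la + (r i).-1)%N.
  by have := r_pos i; have := r_lt_s _ i_neq0; lia.
have [c cE] := schur_sub_rim_hook_expansion (complex R) i_neq0 (r_pos i) s_gt0
  la_part la_neq0 la_size la_large'.
change (sQ r (complex R) i la =
  rim_hook_expansion r i la (qQ r (complex R) i) (sQ r (complex R))).
have -> : sQ r (complex R) = fun j mu => QH_class (s_inv r (complex R) j mu).
  by apply/boolp.funext => j; apply/boolp.funext => mu; rewrite QH_class_s_inv.
rewrite /qQ /QH_class -rmorph_rim_hook_expansion; apply/quot_classP/ideal_predP.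
(* The difference of the two sides is itself one of the generators of the ideal. *)
set F := _ - _; exists 1%N, (fun=> 1), (fun=> F).
split=> [_|]; last by rewrite big_ord1 mul1r.
apply: (omega_mul_in_I_ab i_neq0 (c := c)); rewrite -cE; congr (_ * _).
by rewrite /F -[inv_val _]/(\val _) rmorphB rmorph_rim_hook_expansion.
Qed.
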